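(* Every finite $3$-nilpotent flat semiring is finitely based.
   Context: An additively idempotent semiring (ai-semiring) is an algebra $(S,+,\cdot)$ with two binary operations such that $(S,+)$ is a commutative idempotent semigroup, $(S,\cdot)$ is a semigroup, and both distributive laws $(x+y)z=xz+yz$, $x(y+z)=xy+xz$ hold. A flat semiring is an ai-semiring $S$ whose multiplicative reduct has a zero element $0$ and in which $a+b=0$ for all distinct $a,b\in S$. It is $3$-nilpotent if $a_1a_2a_3=0$ for all $a_1,a_2,a_3\in S$. An algebra is finitely based if the variety it generates (in the signature $(+,\cdot)$) can be defined by finitely many identities. *)

(* Defs.v *)
From Stdlib Require List.
From mathcomp Require Import all_boot.

Set Implicit Arguments.
Unset Strict Implicit.
Unset Printing Implicit Defensive.

Section FlatSemirings.

Variables (T : Type) (add mul : T -> T -> T).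

Record ai_semiring : Prop := AiSemiring {
  ai_addA : associative add;
  ai_addC : commutative add;
  ai_addI : idempotent_op add;
  ai_mulA : associative mul;
  ai_mulDl : left_distributive mul add;
  ai_mulDr : right_distributive mul add
}.

(* [zero] is absorbing for [mul]; it is not neutral for [add]. *)
Record flat_semiring (zero : T) : Prop := FlatSemiring {
  flat_ai : ai_semiring;
  flat_mul0 : left_zero zero mul;
  flat_mulr0 : right_zero zero mul;
  flat_add : forall a b : T, a <> b -> add a b = zero
}.

Definition three_nilpotent (zero : T) : Prop :=
  forall a b c : T, mul (mul a b) c = zero.

End FlatSemirings.

(* Arbitrary algebras of signature (+, .), with no axioms. The carrier may be
   empty: the empty algebra satisfies every identity and embeds in every
   algebra, so it belongs to every nonempty variety and to every equational
   class, and allowing it does not affect finite basedness. *)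
Record algebra : Type := Algebra {
  carrier :> Type;
  aadd : carrier -> carrier -> carrier;
  amul : carrier -> carrier -> carrier
}.

Inductive term : Type :=
| Var of nat
| Add of term & term
| Mul of term & term.

Fixpoint eval (A : algebra) (v : nat -> A) (t : term) : A :=
  match t with
  | Var i => v i
  | Add t1 t2 => aadd (eval v t1) (eval v t2)
  | Mul t1 t2 => amul (eval v t1) (eval v t2)
  end.

Definition identity : Type := (term * term)%type.

Definition satisfies (A : algebra) (e : identity) : Prop :=
  forall v : nat -> A, eval v e.1 = eval v e.2.

Definition is_hom (A B : algebra) (f : A -> B) : Prop :=
  {morph f : x y / aadd x y >-> aadd x y} /\
  {morph f : x y / amul x y >-> amul x y}.

Definition prod_algebra (I : Type) (A : I -> algebra) : algebra :=
  @Algebra (forall i, A i)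
    (fun x y i => aadd (x i) (y i)) (fun x y i => amul (x i) (y i)).

(* Subalgebras are taken up to isomorphism, as sources of embeddings. *)
Record variety (K : algebra -> Prop) : Prop := Variety {
  variety_H : forall (A B : algebra) (f : A -> B),
    is_hom f -> (forall b, exists a, f a = b) -> K A -> K B;
  variety_S : forall (A B : algebra) (f : B -> A),
    is_hom f -> injective f -> K A -> K B;
  variety_P : forall (I : Type) (A : I -> algebra),
    (forall i, K (A i)) -> K (prod_algebra A)
}.

Definition generated_variety (S A : algebra) : Prop :=
  forall K : algebra -> Prop, variety K -> K S -> K A.

Definition finitely_based (S : algebra) : Prop :=
  exists E : seq identity, forall A : algebra,
    generated_variety S A <-> (forall e, List.In e E -> satisfies A e).

(* Main.v *)
Require Import Defs.
From Stdlib Require List.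
From Stdlib Require Import Classical ClassicalEpsilon
  FunctionalExtensionality.
From mathcomp Require Import all_boot zify.

(** Write 0 for [zero].  In a flat semiring a sum differs from 0 only if all
    its summands are equal.  So a term, expanded into a sum of words, takes a
    value c <> 0 exactly when each of its words takes the value c; by
    3-nilpotency these words have one or two letters.  For c <> 0 the pairs
    (a, b) with ab = c form the graph of a partial injection of S
    ([flat_cancelr], [flat_cancell]), that is, a digraph made of disjoint
    directed paths and cycles.  A valuation giving a term the value c is
    essentially a homomorphism into this digraph from the digraph of the
    two-letter words of the term, and such a homomorphism is determined on
    every component by its value at one vertex.

    The basis consists of the semiring laws, the law that a product of three
    factors absorbs every summand, and all identities w + t = t valid in S
    where w is a word and t a sum of words over a fixed number of variables.

    Let A be a model of the basis and T in A.  Order A by a + b = b and draw an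
    edge from a to b when ab <= T.  Any consequence valid in S and concerning
    few elements may be drawn from inequalities w <= T; equivalently, if
    w0 <= T fails, then every short list of elements of A has a map to S that
    sends all words below T in these elements to one c <> 0, but not w0
    ([separate_of_rules]).  The heart of the proof is to obtain such maps for
    arbitrary finite lists ([global_separation]).  Two instances of the rules
    give the shape of the digraph on A: elements with a common neighbour have
    the same neighbours ([twin_edges]), and a chain of |S|! edges closes up to
    a cycle ([chain_closes]), because in S it must run around a cycle whose
    length divides |S|!.  Hence a component, up to identification of elements
    with the same neighbours, is a path or a cycle of bounded length.  A bounded
    list therefore represents the whole component ([saturated_exists]), and a
    map on this list extends to the component ([respects_hull]).  Maps on
    different components are independent and can be glued as soon as they use
    the same c; as there are only |S| candidates, a short list refuting each
    wrong candidate shows that some c works for all short lists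
    ([uniform_separation]).

    Suppose now that two terms with letters in A agree as operations on S but
    have different values in A.  Then, up to symmetry, some word of the second
    term is not below the value T of the first ([word_not_below]), and a global
    map gives the first term the value c but not the second.  So the value in A
    depends only on the operation on S, and A is a homomorphic image of a
    subalgebra of a power of S ([generated_of_diagonal]). *)

Set Implicit Arguments.
Unset Strict Implicit.
Unset Printing Implicit Defensive.

(** * Membership in lists *)

Lemma In_cat X (s t : seq X) x :
  List.In x (s ++ t) <-> List.In x s \/ List.In x t.
Proof. exact: (List.in_app_iff s t x). Qed.

Lemma In_map_iota X (f : nat -> X) n x :
  List.In x [seq f i | i <- iota 0 n] <-> exists2 i, i < n & f i = x.
Proof.
rewrite (List.in_map_iff f); split=> [[i [<- /(List.in_seq n 0)]]|[i lin <-]].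
  by exists i => //; lia.
by exists i; split=> //; apply/(List.in_seq n 0); lia.
Qed.

Lemma In_mem (X : eqType) (s : seq X) x : x \in s -> List.In x s.
Proof.
by elim: s => //= y s IHs; rewrite inE => /orP[/eqP ->|/IHs]; [left|right].
Qed.

Lemma In_image (I : finType) X (f : I -> X) i : List.In (f i) [seq f j | j : I].
Proof. by apply: (List.in_map f); apply: In_mem; rewrite mem_enum. Qed.

(** * Flat semirings *)

Section FlatArithmetic.

Variables (S : finType) (add mul : S -> S -> S) (zero : S).
Hypothesis flatS : flat_semiring add mul zero.
Hypothesis nilS : three_nilpotent mul zero.

Lemma flat_add0 a : add a zero = zero.
Proof.
have [->|/eqP/(flat_add flatS)//] := eqVneq a zero.
exact: (ai_addI (flat_ai flatS)).
Qed.

Lemma flat_add_nonzero a b c :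
  c <> zero -> add a b = c -> a = c /\ b = c.
Proof.
move=> c0; have [->|/eqP nab] := eqVneq a b.
  by rewrite (ai_addI (flat_ai flatS)).
by rewrite (flat_add flatS) // => /esym.
Qed.

Lemma flat_cancelr a b x c :
  c <> zero -> mul a x = c -> mul b x = c -> a = b.
Proof.
move=> c0 ax bx; have [//|/eqP nab] := eqVneq a b; case: c0.
by rewrite -(ai_addI (flat_ai flatS) c) -{1}ax -bx -(ai_mulDl (flat_ai flatS))
  (flat_add flatS) // (flat_mul0 flatS).
Qed.

Lemma flat_cancell a b x c :
  c <> zero -> mul x a = c -> mul x b = c -> a = b.
Proof.
move=> c0 xa xb; have [//|/eqP nab] := eqVneq a b; case: c0.
by rewrite -(ai_addI (flat_ai flatS) c) -{1}xa -xb -(ai_mulDr (flat_ai flatS))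
  (flat_add flatS) // (flat_mulr0 flatS).
Qed.

(** Two of the first |S| + 1 terms of the sequence coincide.  Cancelling on the
    right carries the coincidence back to the start, cancelling on the left
    spreads the resulting period d forward, and d divides |S|!. *)
Lemma flat_chain_closes (s : nat -> S) c :
  c <> zero -> (forall i, i < #|S|`! -> mul (s i) (s i.+1) = c) ->
  s #|S|`! = s 0.
Proof.
set L := #|S|`!; move=> c0 chain.
have leL : #|S| <= L.
  by rewrite /L; case: #|S| => [//|n]; rewrite factS leq_pmulr ?fact_gt0.
have [i [j [lij lejS sij]]] : exists i j, [/\ i < j, j <= #|S| & s i = s j].
  have /injectivePn[x [y nxy sxy]] :
      ~~ injectiveb (fun i : 'I_#|S|.+1 => s i).
    by apply/negP => /injectiveP/leq_card; rewrite card_ord ltnn.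
  have := nxy; rewrite -val_eqE neq_ltn => /orP[lxy|lyx].
    by exists x, y; split=> //; rewrite -ltnS.
  by exists y, x; split=> //; rewrite -ltnS.
have back k : k <= i -> s (i - k) = s (j - k).
  elim: k => [|k IHk] lki; first by rewrite !subn0.
  have ek m : k < m -> (m - k.+1).+1 = m - k by lia.
  apply: (@flat_cancelr _ _ (s (i - k)) c) => //.
    by rewrite -(ek i) //; apply: chain; lia.
  rewrite IHk; last by lia.
  by rewrite -(ek j); [apply: chain; lia|lia].
set d := j - i.
have sd : s 0 = s d by have := back i (leqnn i); rewrite subnn.
have forth k : k + d <= L -> s k = s (k + d).
  elim: k => [//|k IHk] le; apply: (@flat_cancell _ _ (s k) c) => //.
    by apply: chain; lia.
  by rewrite IHk; [apply: chain; lia|lia].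
have mult m : m * d <= L -> s (m * d) = s 0.
  elim: m => [//|m IHm] le; rewrite -IHm; last by lia.
  by rewrite mulSn addnC -forth //; lia.
have /dvdnP[m eL] : d %| L by apply: dvdn_fact; lia.
by rewrite eL mult // -eL.
Qed.

End FlatArithmetic.

(** * Words of length at most two, and the semilattice order *)

Definition word (X : Type) : Type := (X + X * X)%type.

Definition wval (A : algebra) X (f : X -> A) (w : word X) : A :=
  match w with inl x => f x | inr p => amul (f p.1) (f p.2) end.

Definition letters_in X (D : X -> Prop) (w : word X) : Prop :=
  match w with inl x => D x | inr p => D p.1 /\ D p.2 end.

Definition le (A : algebra) (a b : A) : Prop := aadd a b = b.

Definition letters X (w : word X) : seq X :=
  match w with inl x => [:: x] | inr p => [:: p.1; p.2] end.

Lemma letters_in_letters X (w : word X) :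
  letters_in (fun x => List.In x (letters w)) w.
Proof. by case: w => [x|[x y]] /=; auto. Qed.

Lemma sub_letters_in X (D D' : X -> Prop) w :
  (forall x, D x -> D' x) -> letters_in D w -> letters_in D' w.
Proof. by move=> sub; case: w => [x|[x y]] /=; [|case]; auto. Qed.

Lemma eq_wval (A : algebra) X (f g : X -> A) D w :
  (forall x, D x -> f x = g x) -> letters_in D w -> wval f w = wval g w.
Proof.
by move=> fg; case: w => [x|[x y]] /=; [exact: fg|case=> /fg -> /fg ->].
Qed.

Section Order.

Variable A : algebra.
Hypothesis aiA : ai_semiring (@aadd A) (@amul A).
Implicit Types a b c : A.

Lemma le_refl a : le a a.
Proof. exact: (ai_addI aiA). Qed.

Lemma le_trans b a c : le a b -> le b c -> le a c.
Proof. by rewrite /le => ab <-; rewrite (ai_addA aiA) ab. Qed.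

Lemma le_antisym a b : le a b -> le b a -> a = b.
Proof. by rewrite /le => ab; rewrite (ai_addC aiA) ab. Qed.

Lemma le_addl a b : le a (aadd a b).
Proof. by rewrite /le (ai_addA aiA) (ai_addI aiA). Qed.

Lemma le_addr a b : le b (aadd a b).
Proof. by rewrite (ai_addC aiA); exact: le_addl. Qed.

Lemma add_le a b c : le a c -> le b c -> le (aadd a b) c.
Proof. by rewrite /le => ac bc; rewrite -(ai_addA aiA) bc. Qed.

End Order.

(** * Varieties *)

Section Diagonal.

Variables A B : algebra.

(** [diagonal a f] says that some term with letters in [A] has the value [a] in
    [A] and induces the operation [f] of valuations [A -> B]: it is the
    subalgebra of A x B^(B^A) generated by the pairs formed of an element and
    the evaluation at this element.  This relation spares a syntax of terms
    whose variables range over an arbitrary set. *)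
Inductive diagonal : A -> ((A -> B) -> B) -> Prop :=
| Diag_var a : diagonal a (fun v => v a)
| Diag_add a b f g : diagonal a f -> diagonal b g ->
    diagonal (aadd a b) (fun v => aadd (f v) (g v))
| Diag_mul a b f g : diagonal a f -> diagonal b g ->
    diagonal (amul a b) (fun v => amul (f v) (g v)).

(** Birkhoff's argument: the second projection of [diagonal] is a subalgebra of
    a power of [B], and if [diagonal] is the graph of a function then this
    function is a homomorphism from that subalgebra onto [A]. *)
Lemma generated_of_diagonal :
  (forall a b f, diagonal a f -> diagonal b f -> a = b) ->
  generated_variety B A.
Proof.
move=> fun_diag K [homK subK prodK] KB.
pose P := prod_algebra (fun _ : A -> B => B).
pose F := {f : P | exists a, diagonal a f}.
have addP (x y : F) : exists a, diagonal a (aadd (sval x) (sval y)).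
  case: x y => [f [a af]] [g [b bg]]; exists (aadd a b); exact: Diag_add.
have mulP (x y : F) : exists a, diagonal a (amul (sval x) (sval y)).
  case: x y => [f [a af]] [g [b bg]]; exists (amul a b); exact: Diag_mul.
pose FA := @Algebra F (fun x y => exist _ _ (addP x y))
                      (fun x y => exist _ _ (mulP x y)).
have KF : K FA.
  apply: (subK P FA sval); [by split| |exact: prodK].
  move=> [f pf] [g pg] /= fg; case: _ / fg in pg *.
  by rewrite (proof_irrelevance _ pf pg).
pose ev (x : FA) : A :=
  proj1_sig (constructive_indefinite_description _ (svalP x)).
have evP (x : FA) : diagonal (ev x) (sval x).
  by rewrite /ev; case: constructive_indefinite_description.
apply: (homK FA A ev) KF; last first.
  move=> a; have pa : exists b, diagonal b (fun v => v a).
    by exists a; exact: Diag_var.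
  exists (exist (fun f : P => exists b, diagonal b f) _ pa).
  by apply: fun_diag (evP _) _; exact: Diag_var.
split=> x y; apply: fun_diag (evP _) _.
  exact: (Diag_add (evP x) (evP y)).
exact: (Diag_mul (evP x) (evP y)).
Qed.

End Diagonal.

Lemma eval_hom (A B : algebra) (f : A -> B) v t :
  is_hom f -> f (eval v t) = eval (f \o v) t.
Proof. by case=> fD fM; elim: t => //= t1 <- t2 <-. Qed.

Lemma variety_of_models (E : seq identity) :
  variety (fun A => forall e, List.In e E -> satisfies A e).
Proof.
split=> [A B f homf surj satA|A B f homf injf satA|I A satA] e /[dup] eE.
- move=> /satA sat v.
  pose u i := proj1_sig (constructive_indefinite_description _ (surj (v i))).
  have fu i : f (u i) = v i.
    by rewrite /u; case: constructive_indefinite_description.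
  have -> : v = f \o u by apply: functional_extensionality => i; rewrite /= fu.
  by rewrite -!eval_hom // sat.
- by move=> /satA sat v; apply: injf; rewrite !eval_hom.
- move=> _ v; apply: functional_extensionality_dep => i.
  have homi : @is_hom (prod_algebra A) (A i) (fun x => x i) by split.
  have := @eval_hom _ _ _ v e.1 homi; have := @eval_hom _ _ _ v e.2 homi.
  by move=> /= -> ->; exact: satA.
Qed.

(** * The digraph of pairs whose product lies below a given element *)

Section Separation.

Variables (S : finType) (add mul : S -> S -> S) (zero : S).
Hypothesis flatS : flat_semiring add mul zero.
Hypothesis nilS : three_nilpotent mul zero.
Let SA := Algebra add mul.

Variable A : algebra.
Hypothesis aiA : ai_semiring (@aadd A) (@amul A).
Hypothesis absA : forall x y z t : A, le t (amul (amul x y) z).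

Variable T : A.

Definition below (w : word A) : Prop := le (wval id w) T.

Definition edge (a b : A) : Prop := below (inr (a, b)).

(** Restricted to [D], the map [phi] is a homomorphism to the digraph of the
    pairs of product [c] in [S], with the one-letter words below [T] going
    to [c]. *)
Definition respects (phi : A -> S) (c : S) (D : A -> Prop) : Prop :=
  forall w, letters_in D w -> below w -> wval (A := SA) phi w = c.

Definition chain_bound := #|S|`!.
Definition saturated_bound := chain_bound.+2.
(** Room for |S| lists, each consisting of two lists that represent a component,
    and for the letters of one word. *)
Definition sep_bound := #|S| * (saturated_bound + saturated_bound) + 2.

(** This is how the bounded rules enter: below, each rule is obtained by
    separating a hypothetical counterexample in [S]. *)
Hypothesis separate : forall (l : seq A) w,
  size l <= sep_bound -> letters_in (fun x => List.In x l) w -> ~ below w ->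
  exists c phi, [/\ c <> zero, respects phi c (fun x => List.In x l)
                   & wval (A := SA) phi w <> c].

Section Components.

Variable w0 : word A.
Hypothesis w0_notbelow : ~ below w0.

Lemma S_gt0 : 0 < #|S|. Proof. by apply/card_gt0P; exists zero. Qed.

Lemma chain_bound_gt0 : 0 < chain_bound. Proof. exact: fact_gt0. Qed.

Lemma sep_bound_ge : saturated_bound + saturated_bound + 2 <= sep_bound.
Proof. by have := S_gt0; rewrite /sep_bound; nia. Qed.

Lemma size_letters X (w : word X) : size (letters w) <= 2.
Proof. by case: w. Qed.

Lemma respects_sub phi c (D D' : A -> Prop) :
  (forall x, D x -> D' x) -> respects phi c D' -> respects phi c D.
Proof. by move=> sub hom w /(sub_letters_in sub); exact: hom. Qed.

Lemma respects_edge phi c D a b :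
  respects phi c D -> D a -> D b -> edge a b -> mul (phi a) (phi b) = c.
Proof. by move=> hom Da Db; apply: (hom (inr (a, b))). Qed.

Lemma not_edge_mull x y b : ~ edge (amul x y) b.
Proof.
by move=> e; apply: w0_notbelow; exact: (le_trans aiA (absA _ _ _ _) e).
Qed.

Lemma not_edge_mulr x y b : ~ edge b (amul x y).
Proof.
rewrite /edge /below /= (ai_mulA aiA) => e.
by apply: w0_notbelow; exact: (le_trans aiA (absA _ _ _ _) e).
Qed.

(** In [S], if a = c and ab = c then c = cb = cbb = 0.  So an element below [T]
    with an edge would put every word below [T]. *)
Lemma below_no_edge a b : le a T -> ~ edge a b /\ ~ edge b a.
Proof.
have sep : exists c phi, [/\ c <> zero,
    respects phi c (fun x => List.In x ([:: a; b] ++ letters w0))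
      & wval (A := SA) phi w0 <> c].
  apply: separate => //.
    have := sep_bound_ge; have := size_letters w0.
    rewrite /saturated_bound size_cat /=; lia.
  apply: sub_letters_in (letters_in_letters w0) => x xl.
  by apply/In_cat; right.
case: sep => c [phi [c0 hom _]] aT.
have phia : phi a = c by apply: (hom (inl a)) => //=; left.
have [ai bi] : List.In a ([:: a; b] ++ letters w0) /\
  List.In b ([:: a; b] ++ letters w0) by rewrite /=; auto.
split=> e; case: c0.
  have cb : mul c (phi b) = c.
    by rewrite -{1}phia; apply: respects_edge hom _ _ e.
  by transitivity (mul (mul c (phi b)) (phi b)); [rewrite !cb|exact: nilS].
have bc : mul (phi b) c = c.
  by rewrite -{1}phia; apply: respects_edge hom _ _ e.
transitivity (mul (phi b) (mul (phi b) c)); first by rewrite !bc.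
by rewrite (ai_mulA (flat_ai flatS)) nilS.
Qed.

(** In a partial injection such elements coincide. *)
Definition twin (a b : A) : Prop :=
  exists d, (edge a d /\ edge b d) \/ (edge d a /\ edge d b).

Lemma twin_sym a b : twin a b -> twin b a.
Proof. by case=> d; exists d; tauto. Qed.

(** By cancellation in [S], a map respecting the words below [T] identifies
    [a] and [b]. *)
Lemma twin_edges a b d :
  twin a b -> (edge a d -> edge b d) /\ (edge d a -> edge d b).
Proof.
case=> x tab; pose l := [:: a; b; d; x].
have le4 : size l <= sep_bound.
  have := sep_bound_ge; have := chain_bound_gt0.
  by rewrite /saturated_bound /=; lia.
have same c phi : c <> zero -> respects phi c (fun x => List.In x l) ->
    phi a = phi b.
  move=> c0 hom.
  have E y z : List.In y l -> List.In z l -> edge y z ->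
    mul (phi y) (phi z) = c := fun yl zl => respects_edge hom yl zl.
  case: tab => -[e1 e2].
    by apply: (@flat_cancelr _ _ _ _ flatS _ _ (phi x) c) => //;
      apply: E => //=; auto.
  by apply: (@flat_cancell _ _ _ _ flatS _ _ (phi x) c) => //;
    apply: E => //=; auto.
split=> e; apply: NNPP => ne.
  have [|c [phi [c0 hom]]] := @separate l (inr (b, d)) le4 _ ne.
    by rewrite /=; auto.
  by rewrite /= -(same _ _ c0 hom); case; apply: respects_edge hom _ _ e => /=;
    auto.
have [|c [phi [c0 hom]]] := @separate l (inr (d, b)) le4 _ ne.
  by rewrite /=; auto.
by rewrite /= -(same _ _ c0 hom); case; apply: respects_edge hom _ _ e => /=;
  auto.
Qed.

(** Twins are elements with an edge, so twinship is not reflexive at isolated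
    elements. *)
Definition similar (a b : A) : Prop := a = b \/ twin a b.

Lemma similar_sym a b : similar a b -> similar b a.
Proof. by case=> [->|/twin_sym]; [left|right]. Qed.

Lemma similar_edges a b d :
  similar a b -> (edge a d -> edge b d) /\ (edge d a -> edge d b).
Proof. by case=> [->//|/twin_edges]; exact. Qed.

Lemma similar_trans b a d : similar a b -> similar b d -> similar a d.
Proof.
move=> [->//|tab] [<-|[x [[bx dx]|[xb xd]]]]; first by right.
  right; exists x; left; split=> //.
  by apply: (twin_edges x (twin_sym tab)).1.
right; exists x; right; split=> //.
by apply: (twin_edges x (twin_sym tab)).2.
Qed.

(** For a saturated list, defined next, this is the union of the components that
    the list meets. *)
Definition hull (l : seq A) (z : A) : Prop :=
  exists2 x, List.In x l & similar x z.

Definition edge_closed (D : A -> Prop) : Prop :=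
  forall a b, edge a b -> D a <-> D b.

Definition saturated (l : seq A) : Prop := edge_closed (hull l).

Definition chain (f : nat -> A) (k : nat) : Prop :=
  forall i, i < k -> edge (f i) (f i.+1).

(** In [S] the image of such a chain returns to its start, so the last but one
    element has an edge to the first as well as to the last. *)
Lemma chain_closes f :
  chain f chain_bound -> similar (f 0) (f chain_bound).
Proof.
move=> chf; right; exists (f chain_bound.-1); right.
have L0 := chain_bound_gt0.
split; last by have := chf chain_bound.-1; rewrite prednK //; apply.
apply: NNPP => ne; pose l := [seq f i | i <- iota 0 chain_bound.+1].
have in_l i : i <= chain_bound -> List.In (f i) l.
  by move=> lei; apply/In_map_iota; exists i.
have [||c [phi [c0 hom]]] := @separate l (inr (f chain_bound.-1, f 0)) _ _ ne.
- rewrite size_map size_iota; have := sep_bound_ge.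
  by rewrite /saturated_bound; lia.
- by split; apply: in_l; lia.
have E i : i < chain_bound -> mul (phi (f i)) (phi (f i.+1)) = c.
  by move=> li; apply: respects_edge hom _ _ (chf i li); apply: in_l; lia.
have close : phi (f chain_bound) = phi (f 0).
  exact: (flat_chain_closes flatS (s := phi \o f) c0 E).
rewrite /= -close; case.
by have := E chain_bound.-1; rewrite prednK //; apply.
Qed.

Lemma maximal_below (P : nat -> Prop) n : P 1 ->
  exists k, [/\ 0 < k, k <= n.+1, P k & k = n.+1 \/ ~ P k.+1].
Proof.
move=> P1; elim: n => [|n [k [k0 lekn Pk maxk]]].
  by exists 1; split=> //; left.
case: maxk => [ek|nP]; last by exists k; split=> //; [lia|right].
have [PS|nPS] := classic (P n.+2).
  by exists n.+2; split=> //; left.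
by exists k; split=> //; [lia|right; rewrite ek].
Qed.

(** Take a chain of maximal length, among those of length at most |S|!, passing
    through [y] up to similarity.  A neighbour of an inner vertex of the chain
    is a twin of an adjacent vertex of the chain.  A neighbour beyond an end
    would extend the chain, unless its length is |S|!; in that case the chain
    closes up and the neighbour is again a twin of one of its vertices. *)
Lemma saturated_exists y :
  exists l, [/\ List.In y l, size l <= saturated_bound & saturated l].
Proof.
have [[d yd]|iso] := classic (exists d, edge y d \/ edge d y); last first.
  exists [:: y]; split=> //; first by left.
  have isoy z : similar y z -> forall d, ~ edge z d /\ ~ edge d z.
    move=> /similar_sym yz d; split=> e; apply: iso; exists d.
      by left; apply: (similar_edges d yz).1.
    by right; apply: (similar_edges d yz).2.
  move=> a b e; split=> -[x [<-|[]]] /isoy yx.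
    by case: (yx b) => /(_ e).
  by case: (yx a) => _ /(_ e).
pose P k := exists f, chain f k /\ exists2 i, i <= k & similar (f i) y.
have P1 : P 1.
  case: yd => e; [exists (fun i => if i is 0 then y else d)
                 |exists (fun i => if i is 0 then d else y)].
    by split; [case|exists 0 => //; left].
  by split; [case|exists 1 => //; left].
have [k [k0 lekL [f [chf [i0 lei0 fy]]] maxk]] :=
  @maximal_below P chain_bound.-1 P1.
rewrite prednK in lekL maxk; last exact: chain_bound_gt0.
pose l := y :: [seq f i | i <- iota 0 k.+1].
have hullP z : hull l z <-> exists2 i, i <= k & similar (f i) z.
  split=> [[x [<-|xl]] xz|[i lei fz]].
  - by exists i0 => //; exact: similar_trans fy xz.
  - have /In_map_iota[i lei fi] : List.In x [seq f i | i <- iota 0 k.+1] by [].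
    by exists i; rewrite ?fi.
  - have in_l : List.In (f i) [seq f i | i <- iota 0 k.+1].
      by apply/In_map_iota; exists i.
    by exists (f i) => //; right.
exists l; split; first by left.
  by rewrite /= size_map size_iota /saturated_bound; lia.
move=> a b e; rewrite !hullP; split=> -[i lei fi].
  have fb : edge (f i) b by apply: (similar_edges b (similar_sym fi)).1.
  have [ltik|] := ltnP i k.
    by exists i.+1 => //; right; exists (f i); right; split=> //; exact: chf.
  move=> leki; have ei : i = k by lia.
  (* Past the last vertex, [b] extends the chain unless the chain closes up. *)
  case: maxk => [ekL|[]].
    exists 1 => //; right; exists (f 0); right; split; first exact: chf.
    have := @chain_closes f; rewrite -ekL => /(_ chf) cl.
    by apply: (similar_edges b (similar_sym cl)).1; rewrite -ei.
  exists (fun j => if j <= k then f j else b); split.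
    move=> j; rewrite ltnS; case: ltnP => [ltjk _|lekj lejk].
      by rewrite ltnW //; exact: chf.
    have -> : j = k by lia.
    by rewrite leqnn -ei.
  by exists i0; [lia|rewrite lei0].
have af : edge a (f i) by apply: (similar_edges a (similar_sym fi)).2.
(* Before the first vertex, [a] extends the chain or the chain closes up. *)
case: i => [|i] in lei fi af *; last first.
  exists i; [lia|]; right; exists (f i.+1); left; split=> //; exact: chf.
case: maxk => [ekL|[]].
  exists k.-1; [lia|]; right; exists (f k); left; split.
    by have := chf k.-1; rewrite prednK //; apply.
  have := @chain_closes f; rewrite -ekL => /(_ chf) cl.
  exact: (similar_edges a cl).2.
exists (fun j => if j is j'.+1 then f j' else a); split.
  by case=> [//|j] lj; apply: chf.
by exists i0.+1.
Qed.

(** Each element of the hull takes the value of any similar element of the list.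
    The choice does not matter: two twins in [l] share a neighbour, saturation
    replaces it by an element of [l], and cancellation in [S] applies. *)
Lemma respects_hull l phi c : c <> zero -> saturated l ->
  respects phi c (fun x => List.In x l) ->
  exists psi, respects psi c (hull l) /\ forall x, List.In x l -> psi x = phi x.
Proof.
move=> c0 satl hom.
have E a b : List.In a l -> List.In b l -> edge a b ->
  mul (phi a) (phi b) = c := fun al bl => respects_edge hom al bl.
have coh x x' : List.In x l -> List.In x' l -> similar x x' -> phi x = phi x'.
  move=> xl x'l [->//|[b tb]].
  have [b' b'l bb'] : hull l b.
    have hx : hull l x by exists x => //; left.
    by case: tb => -[e _]; apply/(satl _ _ e).
  have T1 := fun u => similar_edges u (similar_sym bb').
  case: tb => -[e1 e2].
    apply: (@flat_cancelr _ _ _ _ flatS _ _ (phi b') c) => //; apply: E => //.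
      exact: (T1 x).2.
    exact: (T1 x').2.
  apply: (@flat_cancell _ _ _ _ flatS _ _ (phi b') c) => //; apply: E => //.
    exact: (T1 x).1.
  exact: (T1 x').1.
pose rep z := epsilon (inhabits z) (fun x => List.In x l /\ similar x z).
have psiE x z : List.In x l -> similar x z -> phi (rep z) = phi x.
  move=> xl xz.
  have [rl rz] : List.In (rep z) l /\ similar (rep z) z.
    by apply: (epsilon_spec (inhabits z)
      (fun x => List.In x l /\ similar x z)); exists x.
  apply: coh => //; exact: similar_trans rz (similar_sym xz).
exists (phi \o rep); split=> [|x xl]; last by apply: psiE => //; left.
case=> [z|[z z']] /=.
  move=> [x xl xz] zT; rewrite (psiE x) //.
  case: xz zT => [<-|[d]] zT; first exact: (hom (inl x)).
  move=> zT'; have [n1 n2] := below_no_edge d zT'.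
  by case: zT => [[_ /n1]|[_ /n2]].
move=> [[x xl xz] [x' x'l xz']] e; rewrite (psiE x) // (psiE x') //.
apply: E => //; apply: (similar_edges _ (similar_sym xz)).1.
exact: (similar_edges _ (similar_sym xz')).2.
Qed.

(** If each c had a short list refuting it, the concatenation of these |S| lists
    could not be separated. *)
Lemma uniform_separation : exists2 c, c <> zero &
  forall l, size l <= saturated_bound + saturated_bound ->
  exists phi, respects phi c (fun x => List.In x l) /\
    (letters_in (fun x => List.In x l) w0 -> wval (A := SA) phi w0 <> c).
Proof.
apply: NNPP => none.
have bad (c : S) : exists l : seq A,
  size l <= saturated_bound + saturated_bound /\
  (c <> zero -> ~ exists phi, respects phi c (fun x => List.In x l) /\
    (letters_in (fun x => List.In x l) w0 -> wval (A := SA) phi w0 <> c)).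
  have [->|/eqP c0] := eqVneq c zero; first by exists [::].
  apply: NNPP => nl; apply: none; exists c => // l szl.
  by apply: NNPP => nphi; apply: nl; exists l.
have [lc lcP] := fin_all_exists bad.
pose l := flatten [seq lc c | c : S] ++ letters w0.
have inlc c x : List.In x (lc c) -> List.In x l.
  move=> xl; apply/In_cat; left.
  by apply/List.in_concat; exists (lc c); split=> //; exact: In_image.
have [||c [phi [c0 hom nw]]] := @separate l w0 _ _ w0_notbelow.
- rewrite size_cat size_flatten /shape -map_comp sumnE big_map big_enum /=.
  rewrite /sep_bound leq_add ?size_letters //.
  rewrite -sum_nat_const; apply: leq_sum => c _; exact: (lcP c).1.
- apply: sub_letters_in (letters_in_letters w0) => x xl.
  by apply/In_cat; right.
case: (lcP c) => _ /(_ c0); apply; exists phi; split=> //.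
by apply: respects_sub hom => x; exact: inlc.
Qed.

(** The components of the letters of [w0] are treated together, so as to keep
    the value of [w0] away from [c]; any other component is added using a
    map on a list that represents it.  No edge joins different components, hence
    the pieces fit together. *)
Lemma global_separation (V : seq A) :
  exists c phi D,
  [/\ c <> zero, edge_closed D /\ (forall x, List.In x V -> D x),
    respects phi c D & wval (A := SA) phi w0 <> c].
Proof.
have [c c0 sepc] := uniform_separation.
suff [phi [D [[clD VD w0D] hom nw]]] : exists phi D,
    [/\ [/\ edge_closed D, forall x, List.In x V -> D x & letters_in D w0],
     respects phi c D & wval (A := SA) phi w0 <> c].
  by exists c, phi, D.
elim: V => [|y V [phi [D [[clD VD w0D] hom nw]]]].
  have [l [szl satl w0l]] : exists l,
      [/\ size l <= saturated_bound + saturated_bound,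
      saturated l & letters_in (fun x => List.In x l) w0].
    have satU l l' : saturated l -> saturated l' -> saturated (l ++ l').
      have hullU z : hull (l ++ l') z <-> hull l z \/ hull l' z.
        split=> [[x /In_cat[xl|xl] xz]|[|][x xl xz]].
        - by left; exists x.
        - by right; exists x.
        - by exists x => //; apply/In_cat; left.
        - by exists x => //; apply/In_cat; right.
      move=> nl nl' a b e; rewrite !hullU.
      by have := nl a b e; have := nl' a b e; tauto.
    case: w0 => [x|[x y]].
      have [l [xl szl nl]] := saturated_exists x; exists l; split=> //; lia.
    have [l [xl szl nl]] := saturated_exists x.
    have [l' [yl szl' nl']] := saturated_exists y.
    exists (l ++ l'); split; [by rewrite size_cat leq_add|exact: satU|].
    by split; apply/In_cat; [left|right].
  have [phi0 [hom0 nw0]] := sepc l szl.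
  have [phi [hom ephi]] := respects_hull c0 satl hom0.
  exists phi, (hull l); split=> //.
    split=> //; apply: sub_letters_in w0l => x xl; exists x => //; by left.
  by rewrite (eq_wval (A := SA) ephi w0l); exact: nw0.
have [l [yl szl satl]] := saturated_exists y.
have [|phi0 [hom0 _]] := sepc l; first by lia.
have [psi [hompsi _]] := respects_hull c0 satl hom0.
pose chi z := if excluded_middle_informative (D z) then phi z else psi z.
have chiD z : D z -> chi z = phi z.
  by rewrite /chi; case: excluded_middle_informative.
have chiN z : ~ D z -> chi z = psi z.
  by rewrite /chi; case: excluded_middle_informative.
exists chi, (fun z => D z \/ hull l z); split.
- split=> [a b e|x [<-|/VD]|].
  + by have := clD a b e; have := satl a b e; tauto.
  + by right; exists y => //; left.
  + by left.
  + by apply: sub_letters_in w0D => x; left.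
- case=> [z|[z z']] /= inz bz.
    have [Dz|nDz] := classic (D z).
      by rewrite chiD //; apply: (hom (inl z)).
    by rewrite chiN //; apply: (hompsi (inl z)) => //=; tauto.
  have clz := clD z z' bz.
  have [Dz|nDz] := classic (D z).
    rewrite chiD // chiD; last by tauto.
    by apply: (hom (inr (z, z'))) => //=; tauto.
  rewrite chiN // chiN; last by tauto.
  by apply: (hompsi (inr (z, z'))) => //=; tauto.
- by rewrite (eq_wval (A := SA) chiD w0D).
Qed.

(** A sum with an edge is a twin of each of its summands, and a product with an
    edge would put every word below [T].  So at an element with an edge every
    term evaluates under [phi] to the value of [phi] there.  Applied to both
    factors, this gives the second claim for a product.  The list [V] collects
    the elements at which this is used. *)
Lemma diagonal_respects a f : diagonal (B := SA) a f -> exists V : seq A,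
  forall phi c D, c <> zero -> edge_closed D -> respects phi c D ->
    (forall x, List.In x V -> D x) ->
    (D a -> (exists b, edge a b \/ edge b a) -> f phi = phi a) /\
    (le a T -> f phi = c).
Proof.
elim=> {a f} [a|a b f g _ [V IHa] _ [W IHb]|a b f g _ [V IHa] _ [W IHb]].
- exists [:: a] => phi c D c0 clD hom VD; split=> // aT.
  by apply: (hom (inl a)) => //; apply: VD; left.
- exists (V ++ W) => phi c D c0 clD hom VD.
  have {}IHa := IHa _ _ _ c0 clD hom
    (fun x xV => VD x (proj2 (In_cat _ _ _) (or_introl xV))).
  have {}IHb := IHb _ _ _ c0 clD hom
    (fun x xV => VD x (proj2 (In_cat _ _ _) (or_intror xV))).
  have ea := le_addl aiA a b; have eb := le_addr aiA a b.
  split=> [Dab [d nd]|abT]; last first.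
    rewrite /= (IHa.2 (le_trans aiA ea abT)) (IHb.2 (le_trans aiA eb abT)).
    exact: (ai_addI (flat_ai flatS)).
  have nbr x : le x (aadd a b) ->
      (edge (aadd a b) d -> edge x d) /\ (edge d (aadd a b) -> edge d x).
    rewrite /edge /below /= => xab; split; apply: le_trans => //.
      by rewrite /le -(ai_mulDl aiA) xab.
    by rewrite /le -(ai_mulDr aiA) xab.
  have val x : le x (aadd a b) ->
      [/\ D x, exists d', edge x d' \/ edge d' x & phi x = phi (aadd a b)].
    move=> /nbr[e1 e2]; case: nd => nd.
      have Dd : D d by apply/(clD _ _ nd).
      have Dx : D x by apply/(clD _ _ (e1 nd)).
      split=> //; first by exists d; left; apply: e1.
      apply: (@flat_cancelr _ _ _ _ flatS _ _ (phi d) c) => //.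
        exact: respects_edge hom Dx Dd (e1 nd).
      exact: respects_edge hom Dab Dd nd.
    have Dd : D d by apply/(clD _ _ nd).
    have Dx : D x by apply/(clD _ _ (e2 nd)).
    split=> //; first by exists d; right; apply: e2.
    apply: (@flat_cancell _ _ _ _ flatS _ _ (phi d) c) => //.
      exact: respects_edge hom Dd Dx (e2 nd).
    exact: respects_edge hom Dd Dab nd.
  have [Da na pa] := val a ea; have [Db nb pb] := val b eb.
  rewrite /= (IHa.1 Da na) (IHb.1 Db nb) pa pb.
  exact: (ai_addI (flat_ai flatS)).
- exists ([:: a; b] ++ V ++ W) => phi c D c0 clD hom VD.
  have {}IHa := IHa _ _ _ c0 clD hom (fun x xV => VD x
    (or_intror (or_intror (proj2 (In_cat _ _ _) (or_introl xV))))).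
  have {}IHb := IHb _ _ _ c0 clD hom (fun x xV => VD x
    (or_intror (or_intror (proj2 (In_cat _ _ _) (or_intror xV))))).
  split=> [_ [d [/not_edge_mull|/not_edge_mulr]]|abT] //=.
  have [Da Db] : D a /\ D b by split; apply: VD; [left|right; left].
  rewrite (IHa.1 Da); last by exists b; left.
  rewrite (IHb.1 Db); last by exists a; right.
  exact: respects_edge hom Da Db abT.
Qed.

End Components.

(** Distributing the product over the sum [s] produces a letter whose product
    with [b] is not below [T].  If instead [s] contains a product, the chosen
    element is this product, and the implication holds because three factors
    multiply to 0 in [S]. *)
Lemma left_letter s g b : diagonal (B := SA) s g -> ~ edge s b ->
  exists a, ~ edge a b /\
    forall phi x c, c <> zero -> mul (g phi) x = c -> mul (phi a) x = c.
Proof.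
elim=> {s g} [a|p q f g _ IHp _ IHq|p q f g _ _ _ _] nb.
- by exists a.
- have [np|nq] : ~ edge p b \/ ~ edge q b.
  + apply: NNPP => n; apply: nb; rewrite /edge /below /= (ai_mulDl aiA).
    by apply: (add_le aiA); apply: NNPP; tauto.
  + have [a [na aP]] := IHp np; exists a; split=> // phi x c c0.
    rewrite /= (ai_mulDl (flat_ai flatS)) => /(flat_add_nonzero flatS c0)[e _].
    exact: aP e.
  + have [a [na aP]] := IHq nq; exists a; split=> // phi x c c0.
    rewrite /= (ai_mulDl (flat_ai flatS)) => /(flat_add_nonzero flatS c0)[_ e].
    exact: aP e.
- by exists (amul p q); split=> // phi x c c0 /=; rewrite nilS => /esym.
Qed.

Lemma right_letter s g b : diagonal (B := SA) s g -> ~ edge b s ->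
  exists a, ~ edge b a /\
    forall phi x c, c <> zero -> mul x (g phi) = c -> mul x (phi a) = c.
Proof.
elim=> {s g} [a|p q f g _ IHp _ IHq|p q f g _ _ _ _] nb.
- by exists a.
- have [np|nq] : ~ edge b p \/ ~ edge b q.
  + apply: NNPP => n; apply: nb; rewrite /edge /below /= (ai_mulDr aiA).
    by apply: (add_le aiA); apply: NNPP; tauto.
  + have [a [na aP]] := IHp np; exists a; split=> // phi x c c0.
    rewrite /= (ai_mulDr (flat_ai flatS)) => /(flat_add_nonzero flatS c0)[e _].
    exact: aP e.
  + have [a [na aP]] := IHq nq; exists a; split=> // phi x c c0.
    rewrite /= (ai_mulDr (flat_ai flatS)) => /(flat_add_nonzero flatS c0)[_ e].
    exact: aP e.
- exists (amul p q); split=> // phi x c c0 /=.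
  by rewrite (ai_mulA (flat_ai flatS)) nilS => /esym.
Qed.

(** A nonzero sum in [S] equals each of its summands, so every word of a term
    inherits a nonzero value of the term. *)
Lemma word_not_below s g : diagonal (B := SA) s g -> ~ le s T ->
  exists w, ~ below w /\
    forall phi c, c <> zero -> g phi = c -> wval (A := SA) phi w = c.
Proof.
elim=> {s g} [a|p q f g _ IHp _ IHq|p q f g fp _ gq _] nT.
- by exists (inl a).
- have [/IHp|/IHq] : ~ le p T \/ ~ le q T.
  + apply: NNPP => n; apply: nT.
    by apply: (add_le aiA); apply: NNPP; tauto.
  + move=> [w [nw wP]]; exists w; split=> // phi c c0.
    by move=> /(flat_add_nonzero flatS c0)[e _]; exact: wP.
  + move=> [w [nw wP]]; exists w; split=> // phi c c0.
    by move=> /(flat_add_nonzero flatS c0)[_ e]; exact: wP.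
- have [a [na aP]] := left_letter fp nT.
  have [b [nb bP]] := right_letter gq na.
  by exists (inr (a, b)); split=> // phi c c0 /aP e; apply: bP => //; apply: e.
Qed.

(** Were [s] not below [T], a word of the second term would not be below [T]; a
    map separating it sends both terms to [c], hence also that word. *)
Lemma diagonal_le s f :
  diagonal (B := SA) T f -> diagonal (B := SA) s f -> le s T.
Proof.
move=> fT fs; apply: NNPP => /(word_not_below fs)[w [nw wP]].
have [V VP] := diagonal_respects nw fT.
have [c [phi [D [c0 [clD VD] hom]]]] := global_separation nw V.
apply; apply: wP => //.
by apply: (VP phi c D c0 clD hom VD).2; exact: le_refl.
Qed.

End Separation.

(** * The finite basis *)

Definition base_laws : seq identity :=
  let x := Var 0 in let y := Var 1 in let z := Var 2 in let t := Var 3 in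
  [:: (Add x (Add y z), Add (Add x y) z); (Add x y, Add y x); (Add x x, x);
      (Mul x (Mul y z), Mul (Mul x y) z);
      (Mul (Add x y) z, Add (Mul x z) (Mul y z));
      (Mul x (Add y z), Add (Mul x y) (Mul x z));
      (Add t (Mul (Mul x y) z), Mul (Mul x y) z)].

Lemma models_base_laws (A : algebra) :
  (forall e, List.In e base_laws -> satisfies A e) <->
  ai_semiring (@aadd A) (@amul A) /\
  forall x y z t : A, le t (amul (amul x y) z).
Proof.
split=> [sat|[[addA addC addI mulA mulDl mulDr] top] e].
  have law i (x y z t : A) : i < 7 ->
      let e := nth (Var 0, Var 0) base_laws i in
      eval (nth t [:: x; y; z]) e.1 = eval (nth t [:: x; y; z]) e.2.
    move=> lti; apply: sat; move: i lti.
    by do 7![case=> [_|]; first by rewrite /=; tauto].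
  split=> [|x y z t]; last exact: (law 6 x y z t).
  split=> [x y z|x y|x|x y z|x y z|x y z].
  - exact: (law 0 x y z x).
  - exact: (law 1 x y x x).
  - exact: (law 2 x x x x).
  - exact: (law 3 x y z x).
  - exact: (law 4 x y z x).
  - exact: (law 5 x y z x).
by do ![case=> [<- v /=|]] => //; exact: top.
Qed.

Definition wmap X Y (f : X -> Y) (w : word X) : word Y :=
  match w with inl x => inl (f x) | inr p => inr (f p.1, f p.2) end.

Lemma wval_wmap (A : algebra) X Y (f : Y -> A) (g : X -> Y) w :
  wval f (wmap g w) = wval (f \o g) w.
Proof. by case: w => [x|[x y]]. Qed.

Definition word_term (w : word nat) : term :=
  match w with inl i => Var i | inr p => Mul (Var p.1) (Var p.2) end.

Lemma eval_word_term (A : algebra) (v : nat -> A) w :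
  eval v (word_term w) = wval v w.
Proof. by case: w => [x|[x y]]. Qed.

(** The variable 0 stands for the upper bound [T] and makes the sum nonempty. *)
Definition sum_term (ws : seq (word nat)) : term :=
  foldr (fun w t => Add (word_term w) t) (Var 0) ws.

Definition rule (ws : seq (word nat)) (w : word nat) : identity :=
  (Add (word_term w) (sum_term ws), sum_term ws).

Lemma eval_sum_term_le (A : algebra) (v : nat -> A) ws :
  (forall w, w \in ws -> le (wval v w) (v 0)) -> eval v (sum_term ws) = v 0.
Proof.
elim: ws => //= w ws IHws le_ws; rewrite IHws; last first.
  by move=> u uws; apply: le_ws; rewrite inE uws orbT.
by rewrite eval_word_term; apply: le_ws; rewrite inE eqxx.
Qed.

(** Serves to extract from the finitely many candidate identities those that are
    valid in [S]. *)
Lemma sublist_of_prop X (P : X -> Prop) (s : seq X) :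
  exists s', forall x, List.In x s' <-> List.In x s /\ P x.
Proof.
elim: s => [|y s [s' s'P]]; first by exists [::] => x /=; tauto.
have [Py|nPy] := classic (P y).
  by exists (y :: s') => x /=; rewrite s'P; split=> [[<-|]|]; tauto.
exists s' => x; rewrite s'P /=; split; first by tauto.
by case=> [[<-|]]; tauto.
Qed.

Definition bounded_rule m
    (p : {set 'I_m + 'I_m * 'I_m} * ('I_m + 'I_m * 'I_m)) : identity :=
  rule [seq wmap (@nat_of_ord m) w | w <- enum p.1] (wmap (@nat_of_ord m) p.2).

Definition small_rules (m : nat) : seq identity :=
  [seq bounded_rule p | p : {set 'I_m + 'I_m * 'I_m} * ('I_m + 'I_m * 'I_m)].

Section Rules.

Variables (S : finType) (add mul : S -> S -> S) (zero : S).
Hypothesis flatS : flat_semiring add mul zero.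
Let SA := Algebra add mul.

Lemma eval_sum_term_flat (v : nat -> S) ws w :
  eval (A := SA) v (sum_term ws) <> zero -> w \in ws ->
  wval (A := SA) v w = eval (A := SA) v (sum_term ws).
Proof.
elim: ws => //= u ws IHws nz; rewrite inE.
have [eu es] := flat_add_nonzero flatS nz erefl.
move=> /orP[/eqP ->|wws]; first by rewrite -eval_word_term.
by rewrite IHws // es.
Qed.

(** Let t be the sum of all words below [T] over the listed elements, with these
    replaced by variables.  In [A] the value of t is [T], so the identity
    w + t = t fails in [A]; hence it is not a rule, and a valuation refuting it
    in [S] is the desired map. *)
Lemma separate_of_rules (A : algebra) m (T : A) (l : seq A) (w : word A) :
  (forall e, List.In e (small_rules m.+1) -> satisfies SA e ->
    satisfies A e) ->
  size l <= m -> letters_in (fun x => List.In x l) w -> ~ below T w ->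
  exists c phi, [/\ c <> zero,
    respects add mul T phi c (fun x => List.In x l)
    & wval (A := SA) phi w <> c].
Proof.
move=> rulesA szl wl nw.
pose v := nth T (T :: l).
pose pos x : 'I_m.+1 := epsilon (inhabits ord0) (fun i : 'I_m.+1 => v i = x).
have posK x : List.In x l -> v (pos x) = x.
  move=> xl; apply: (epsilon_spec (inhabits ord0) (fun i : 'I_m.+1 => v i = x)).
  have [i lti <-] : exists2 i, i < size l & nth T l i = x.
    elim: (l) xl => //= y l' IHl [->|/IHl[i lti <-]]; first by exists 0.
    by exists i.+1.
  have lti' : i.+1 < m.+1 by lia.
  by exists (Ordinal lti').
have val_pos u : letters_in (fun x => List.In x l) u ->
    wval v (wmap (@nat_of_ord _) (wmap pos u)) = wval id u.
  by move=> ul; rewrite !wval_wmap; apply: eq_wval ul => x /posK.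
pose D := [set u : 'I_m.+1 + 'I_m.+1 * 'I_m.+1 |
  if excluded_middle_informative (le (wval v (wmap (@nat_of_ord _) u)) T)
  then true else false].
have DP u : u \in D <-> le (wval v (wmap (@nat_of_ord _) u)) T.
  by rewrite inE; case: excluded_middle_informative.
pose ws := [seq wmap (@nat_of_ord m.+1) u | u <- enum D].
pose e := bounded_rule (D, wmap pos w).
have nsat : ~ satisfies SA e.
  move=> satS; apply: nw; rewrite /below -val_pos //.
  have eE : List.In e (small_rules m.+1).
    exact: (In_image (@bounded_rule m.+1) (D, wmap pos w)).
  have := rulesA e eE satS v; rewrite /= eval_word_term eval_sum_term_le //.
  by move=> _ /mapP[u + ->]; rewrite mem_enum => /DP.
have [psi /= npsi] := not_all_ex_not _ _ nsat.
set c := eval psi (sum_term ws) in npsi; rewrite eval_word_term in npsi.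
have c0 : c <> zero.
  by move=> c0; apply: npsi; rewrite c0; exact: flat_add0 flatS _.
exists c, (psi \o (@nat_of_ord _) \o pos); split=> // [u ul uT|]; last first.
  rewrite wval_wmap wval_wmap in npsi => ew; apply: npsi.
  by rewrite ew; exact: (ai_addI (flat_ai flatS)).
rewrite -(wval_wmap (A := SA)) -(wval_wmap (A := SA)).
apply: eval_sum_term_flat => //; apply: map_f; rewrite mem_enum; apply/DP.
by rewrite val_pos.
Qed.

End Rules.

Theorem corollary3p9 (S : finType) (add mul : S -> S -> S) (zero : S) :
  flat_semiring add mul zero ->
  three_nilpotent mul zero ->
  finitely_based (Algebra add mul).
Proof.
move=> flatS nilS; pose SA := Algebra add mul.
have absS (x y z t : SA) : le t (amul (amul x y) z).
  by rewrite /le /= nilS (flat_add0 flatS).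
have [R RP] := sublist_of_prop (satisfies SA) (small_rules (sep_bound S).+1).
exists (base_laws ++ R) => A; split=> [genA|satA].
  apply: (genA _ (variety_of_models (base_laws ++ R))) => e /In_cat[|].
    by move: e; apply/models_base_laws; split=> //; exact: flat_ai flatS.
  by case/RP.
have [aiA absA] : ai_semiring (@aadd A) (@amul A) /\
    forall x y z t : A, le t (amul (amul x y) z).
  by apply/models_base_laws => e eE; apply: satA; apply/In_cat; left.
have rulesA e : List.In e (small_rules (sep_bound S).+1) -> satisfies SA e ->
    satisfies A e.
  by move=> eE satS; apply: satA; apply/In_cat; right; exact/RP.
have sep (T : A) l w := @separate_of_rules _ _ _ _ flatS A _ T l w rulesA.
have le_diag (a b : A) f : diagonal (B := SA) a f -> diagonal (B := SA) b f ->
    le b a.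
  exact: (diagonal_le flatS nilS aiA absA (sep a)).
apply: generated_of_diagonal => a b f af bf.
by apply: (le_antisym aiA); [exact: le_diag bf af|exact: le_diag af bf].
Qed.
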